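(* Let $n\ge 1$, let $\alpha,\lambda>0$, and let $\beta_1,\dots,\beta_n>0$ and $\beta_1^*,\dots,\beta_n^*>0$. Let $X_1,\dots,X_n$ be independent random variables with $X_i\sim \mathrm{ENH}(\alpha,\lambda,\beta_i)$, and let $X_1^*,\dots,X_n^*$ be another set of independent random variables with $X_i^*\sim \mathrm{ENH}(\alpha,\lambda,\beta_i^* )$, $i=1,\dots,n$. Write $X_{n:n}=\max_i X_i$ and $X^*_{n:n}=\max_i X_i^*$. Then $X_{n:n}\ge_{\mathrm{lr}}X^*_{n:n}$ if and only if $\sum_{i=1}^n\beta_i\ge\sum_{i=1}^n\beta_i^*$.
   Context: For $\alpha,\lambda,\beta>0$, $X\sim \mathrm{ENH}(\alpha,\lambda,\beta)$ (exponentiated Nadarajah-Haghighi distribution) means that $X$ is a positive random variable with distribution function $[1-\exp\{1-(1+\lambda x)^{\alpha}\}]^{\beta}$ for $x>0$ (and $0$ for $x\le 0$). Likelihood ratio order: for non-negative random variables $X,Y$ with densities $f,g$ respectively, $X\le_{\mathrm{lr}}Y$ (equivalently $Y\ge_{\mathrm{lr}}X$) means that $g(x)/f(x)$ is increasing (i.e. nondecreasing) in $x\in(0,\infty)$. Densities of ENH-type variables are taken to be the derivatives of the distribution functions on $(0,\infty)$. *)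

(* Defs.v *)
From HB Require Import structures.
From mathcomp Require Import all_boot all_order all_algebra.
From mathcomp Require Import all_classical all_reals all_analysis.
From mathcomp Require Import measurable_realfun.
Set Implicit Arguments.
Unset Strict Implicit.
Unset Printing Implicit Defensive.
Import Order.TTheory GRing.Theory Num.Theory.
Import numFieldNormedType.Exports.

Local Open Scope classical_set_scope.
Local Open Scope ring_scope.

Section definitions.
Context {d : measure_display} {T : measurableType d} {R : realType}.
Variable P : probability T R.

Definition mutually_independent (n : nat) (X : 'I_n -> {RV P >-> R}) : Prop :=
  forall (J : {set 'I_n}) (A : 'I_n -> set R),
    (forall i, measurable (A i)) ->
    P (\bigcap_(i in [set` J]) (X i @^-1` A i)) =
    (\prod_(i in J) P (X i @^-1` A i))%E.

Definition enh_cdf (alpha lambda beta x : R) : R :=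
  if 0 < x then (1 - expR (1 - (1 + lambda * x) `^ alpha)) `^ beta else 0.

Definition is_ENH (alpha lambda beta : R) (X : {RV P >-> R}) : Prop :=
  {ae P, forall t, 0 < X t} /\
  forall x : R, cdf X x = (enh_cdf alpha lambda beta x)%:E.

(* [f] is the density on (0, +oo) of a non-negative random variable [X]: [X]
   has distribution function [x |-> \int_0^x f] (for [x <= 0] the domain is
   empty, hence [X > 0] almost surely), and the version of the density is
   fixed by requiring it to be the derivative of the distribution function at
   every [x > 0]. The values of [f] outside (0, +oo) are irrelevant. *)
Definition has_density (X : {RV P >-> R}) (f : R -> R) : Prop :=
  [/\ forall x : R, 0 < x -> 0 <= f x,
      measurable_fun (`]0, +oo[ : set R) f,
      forall x : R,
        cdf X x = (\int[lebesgue_measure]_(t in `]0%R, x]) (f t)%:E)%E &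
      forall x : R, 0 < x -> is_derive x 1 (fun y => fine (cdf X y)) (f x)].

(* The default value of the iterated maximum is one of the [X i], so that
   no artificial value enters the maximum. *)
Definition sample_max (n : nat) (n_gt0 : (0 < n)%N)
    (X : 'I_n -> {RV P >-> R}) : T -> R :=
  fun t => \big[Num.max/X (Ordinal n_gt0) t]_(i < n) X i t.

Lemma measurable_sample_max (n : nat) (n_gt0 : (0 < n)%N)
    (X : 'I_n -> {RV P >-> R}) :
  measurable_fun [set: T] (sample_max n_gt0 X).
Proof.
rewrite /sample_max; elim: (index_enum _) => [|i s IHs].
  under eq_fun do rewrite big_nil.
  exact: measurable_funPT.
under eq_fun do rewrite big_cons.
by apply: measurable_maxr => //; exact: measurable_funPT.
Qed.

HB.instance Definition _ (n : nat) (n_gt0 : (0 < n)%N)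
    (X : 'I_n -> {RV P >-> R}) :=
  isMeasurableFun.Build _ _ T R (sample_max n_gt0 X)
    (measurable_sample_max n_gt0 X).

End definitions.

(* [lr_le X Y] is X <=_lr Y. The order only depends on the distributions, so
   [X] and [Y] may live on different probability spaces. Positivity of the
   density of [X] makes the ratio [g / f] meaningful on the whole of (0, +oo). *)
Definition lr_le (R : realType)
    (d1 : measure_display) (T1 : measurableType d1) (P1 : probability T1 R)
    (d2 : measure_display) (T2 : measurableType d2) (P2 : probability T2 R)
    (X : {RV P1 >-> R}) (Y : {RV P2 >-> R}) : Prop :=
  exists f g : R -> R,
    [/\ has_density X f, has_density Y g,
        forall x : R, 0 < x -> 0 < f x &
        forall x y : R, 0 < x -> x <= y -> g x / f x <= g y / f y].

(* Main.v *)
Require Import Defs.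
From mathcomp Require Import all_boot all_order all_algebra.
From mathcomp Require Import all_classical all_reals all_analysis.
From mathcomp Require Import measurable_realfun.
Set Implicit Arguments.
Unset Strict Implicit.
Unset Printing Implicit Defensive.
Import Order.TTheory GRing.Theory Num.Theory.
Import numFieldNormedType.Exports.
Local Open Scope ring_scope.

(** Write [G] for the Nadarajah-Haghighi distribution function
    [x |-> 1 - exp (1 - (1 + lambda * x)^alpha)], so that ENH(alpha, lambda, b)
    has distribution function [G^b] on the positive half-line. The maximum of
    independent variables has as distribution function the product of the
    individual ones ([cdf_sample_max]), and a product of powers of [G] is again
    a power of [G]: the maximum of the sample is ENH(alpha, lambda, B) with
    [B] the sum of the shape parameters ([cdf_sample_max_ENH]). The problem
    is thus reduced to comparing two ENH variables that differ only by their
    last parameter.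

    The density of ENH(alpha, lambda, b) is [b * G^(b - 1) * G'], hence the
    ratio of the densities for [b] and [c] is [(b / c) * G^(b - c)]
    ([enh_pdf_ratio]): the factor [G'] cancels. As [G] is positive and strictly
    increasing, this is nondecreasing if and only if [c <= b]
    ([enh_pdf_ratio_nondecreasing]).

    What links this computation to the likelihood ratio order is that the
    density is pinned down pointwise, as the derivative of the distribution
    function. Uniqueness is then immediate
    ([density_sample_max_ENH_unique]). Existence requires that the distribution
    function be the integral of its derivative on the whole of [(0, x]], although
    that derivative is unbounded near [0] when [b < 1]
    ([has_density_derivative]). *)

(** * Densities obtained by differentiating a distribution function *)

Section density_of_derivative.
Local Open Scope classical_set_scope.
Context {d : measure_display} {T : measurableType d} {R : realType}.
Context (P : probability T R).

(** The density may be unbounded near [0], so the fundamental theorem of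
    calculus is applied on [[1/(n+1), x]] only. Monotone convergence exhausts
    [(0, x]], and the boundary term [cdf X (1/(n+1))] vanishes in the limit
    because a distribution function is right-continuous and this one is zero
    at [0]. *)
Lemma has_density_derivative (X : {RV P >-> R}) (f : R -> R) :
  cdf X 0 = 0%E ->
  (forall x : R, 0 < x -> 0 <= f x) ->
  (forall x : R, 0 < x -> {for x, continuous f}) ->
  (forall x : R, 0 < x -> is_derive x 1 (fun y => fine (cdf X y)) (f x)) ->
  has_density X f.
Proof.
move=> X0 f0 cf df.
have mf : measurable_fun (`]0, +oo[ : set R) f.
  apply: open_continuous_measurable_fun; first exact: interval_open.
  by move=> x; rewrite inE/= in_itv/= andbT; exact: cf.
have fin x : cdf X x \is a fin_num by exact: fin_num_measure.
have FTC (a b : R) : 0 < a -> a < b ->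
    (\int[lebesgue_measure]_(t in `[a, b]) (f t)%:E = cdf X b - cdf X a)%E.
  move=> a0 ab.
  have cF (x : R) : 0 < x -> {for x, continuous (fun y => fine (cdf X y))}.
    move=> x0; apply: differentiable_continuous.
    by apply/derivable1_diffP; have [] := df x x0.
  rewrite (@continuous_FTC2 _ f (fun y => fine (cdf X y)))//.
  - by rewrite !fineK.
  - apply: continuous_in_subspaceT => x; rewrite inE/= in_itv/= => /andP[ax _].
    exact/cf/(lt_le_trans a0).
  - split.
    + move=> x; rewrite in_itv/= => /andP[ax _].
      by have [] := df _ (lt_trans a0 ax).
    + exact/cvg_at_right_filter/cF.
    + exact/cvg_at_left_filter/cF/(lt_trans a0).
  - move=> x; rewrite in_itv/= => /andP[ax _].
    by rewrite derive1E; have [] := df _ (lt_trans a0 ax).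
split => // x; have [x0|x0] := leP x 0.
  rewrite set_itv_ge ?bnd_simp -?leNgt// integral_set0.
  by apply/eqP; rewrite eq_le cdf_ge0 -X0 cdf_nondecreasing.
rewrite itv_open_bnd_bigcup.
have ints_cvg_cdf : (\int[lebesgue_measure]_(t in `[(0 + n.+1%:R^-1)%R, x])
    (f t)%:E)%E @[n --> \oo] --> cdf X x.
  have invn : (0 + n.+1%:R^-1)%R @[n --> \oo] --> (0 : R).
    rewrite -[X in _ --> X](addr0 0).
    by apply: cvgD; [exact: cvg_cst|exact: cvg_harmonic].
  have : (cdf X x - cdf X (0 + n.+1%:R^-1)%R)%E @[n --> \oo] --> cdf X x.
    rewrite -[X in _ --> X](sube0 (cdf X x)).
    apply: cvgeB; [by rewrite fin_num_adde_defl| exact: cvg_cst|].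
    have /cvge_at_rightP : cdf X t @[t --> 0^'+] --> (0%R : R)%:E.
      by rewrite [X in _ --> X](esym X0); exact: cdf_right_continuous.
    by apply; split => // n; rewrite add0r.
  apply: cvg_trans; apply: near_eq_cvg; near=> n.
  rewrite FTC//.
  by near: n; apply: cvgr_lt x0.
apply: cvg_unique ints_cvg_cdf _ => //.
apply: ge0_nondecreasing_set_cvg_integral.
- move=> m n mn; apply/subsetPset => t/=; rewrite !in_itv/= => /andP[+ ->].
  rewrite andbT; apply: le_trans; rewrite lerD2l lef_pV2 ?posrE//.
  by rewrite ler_nat.
- by move=> n; exact: measurable_itv.
- move=> n; apply/measurable_EFinP; apply: measurable_funS mf => //.
  by move=> t/=; rewrite !in_itv/= andbT add0r => /andP[+ _]; exact: lt_le_trans.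
- move=> n t/=; rewrite in_itv/= lee_fin add0r => /andP[nt _].
  exact/f0/(lt_le_trans _ nt).
Unshelve. all: by end_near. Qed.

End density_of_derivative.

(** * Maximum of independent random variables *)

Section maximum.
Local Open Scope classical_set_scope.
Context {d : measure_display} {T : measurableType d} {R : realType}.
Context (P : probability T R) (n : nat) (n_gt0 : (0 < n)%N).

Lemma cdf_sample_max (X : 'I_n -> {RV P >-> R}) (x : R) :
  mutually_independent X ->
  cdf (sample_max n_gt0 X : {RV P >-> R}) x = (\prod_(i < n) cdf (X i) x)%E.
Proof.
move=> /(_ [set: 'I_n]%SET (fun=> `]-oo, x])) indep.
transitivity
    (\prod_(i in [set: 'I_n]%SET) P (X i @^-1` `]-oo, x]))%E; last first.
  by apply: eq_bigl => i; rewrite inE.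
rewrite -indep; last by move=> i; exact: measurable_itv.
rewrite /cdf /distribution /pushforward; congr (P _).
apply/seteqP; split => t /=; rewrite in_itv/= /sample_max => le_x.
  move=> i _ /=; rewrite in_itv/=; apply: le_trans le_x.
  exact: le_bigmax.
have Xx i : X i t <= x.
  by have /(_ i) := le_x; rewrite /= in_itv/= => -> //; rewrite inE.
exact: bigmax_le.
Qed.

End maximum.

(** * Exponentiated Nadarajah-Haghighi distributions *)

Lemma lt0_gtr_powR {R : realType} (a x y : R) :
  a < 0 -> 0 < x -> x < y -> y `^ a < x `^ a.
Proof.
move=> a0 x0 xy; have y0 := lt_trans x0 xy.
rewrite -(opprK a) powRN [ltRHS]powRN ltf_pV2 ?posrE ?powR_gt0//.
by rewrite gt0_ltr_powR ?nnegrE ?oppr_gt0 ?(ltW x0) ?(ltW y0).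
Qed.

Section exponentiated_Nadarajah_Haghighi.
Local Open Scope classical_set_scope.
Context {R : realType} (alpha lambda : R).
Hypotheses (alpha_gt0 : 0 < alpha) (lambda_gt0 : 0 < lambda).

Definition nh_cdf (x : R) : R := 1 - expR (1 - (1 + lambda * x) `^ alpha).

Definition nh_pdf (x : R) : R :=
  expR (1 - (1 + lambda * x) `^ alpha) *
  (alpha * (1 + lambda * x) `^ (alpha - 1) * lambda).

Definition enh_pdf (b x : R) : R := b * nh_cdf x `^ (b - 1) * nh_pdf x.

Let base_gt1 (x : R) : 0 < x -> 1 < 1 + lambda * x.
Proof. by move=> x0; rewrite ltrDl mulr_gt0. Qed.

Let base_gt0 (x : R) : 0 < x -> 0 < 1 + lambda * x.
Proof. by move=> /base_gt1; exact: lt_trans. Qed.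

(** Since [1 + lambda * x > 1] and [alpha > 0], its power exceeds [1] and the
    exponent in [nh_cdf] is negative. *)
Lemma nh_cdf_gt0 (x : R) : 0 < x -> 0 < nh_cdf x.
Proof.
move=> x0; rewrite subr_gt0 expR_lt1 subr_lt0 -[ltLHS](powRr0 (1 + lambda * x)).
by rewrite /powR gt_eqF ?base_gt0// ltr_expR ltr_pM2r ?ln_gt0 ?base_gt1.
Qed.

Lemma nh_cdf_lt (x y : R) : 0 < x -> x < y -> nh_cdf x < nh_cdf y.
Proof.
move=> x0 xy; have y0 := lt_trans x0 xy.
rewrite ltrD2l ltrN2 ltr_expR ltrD2l ltrN2 gt0_ltr_powR ?nnegrE//.
- exact/ltW/base_gt0.
- exact/ltW/base_gt0.
- by rewrite ltrD2l ltr_pM2l.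
Qed.

Lemma nh_pdf_gt0 (x : R) : 0 < x -> 0 < nh_pdf x.
Proof. by move=> x0; rewrite !mulr_gt0 ?expR_gt0 ?powR_gt0 ?base_gt0. Qed.

Lemma enh_pdf_gt0 (b x : R) : 0 < b -> 0 < x -> 0 < enh_pdf b x.
Proof.
move=> b0 x0; apply: mulr_gt0; last exact: nh_pdf_gt0.
by rewrite mulr_gt0 ?powR_gt0 ?nh_cdf_gt0.
Qed.

Let is_derive_base (x : R) : is_derive x 1 (fun y => 1 + lambda * y) lambda.
Proof.
have := is_deriveD (is_derive_cst (1 : R) x 1)
  (is_deriveZ lambda (is_derive_id x 1)).
by rewrite add0r -[lambda%:A]/(lambda * 1) mulr1.
Qed.

Lemma is_derive_nh_cdf (x : R) : 0 < x -> is_derive x 1 nh_cdf (nh_pdf x).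
Proof.
move=> x0; have h0 := base_gt0 x0.
have dpow := @is_derive1_comp _ (@powR R ^~ alpha) (fun y => 1 + lambda * y) x _ _
  (@is_derive1_powR R alpha _ h0) (is_derive_base x).
rewrite /nh_cdf; have dexp := @is_derive1_comp _ expR
  (fun y => 1 - (1 + lambda * y) `^ alpha) x _ _
  (is_derive_expR _) (is_deriveB (is_derive_cst (1 : R) x 1) dpow).
apply: is_derive_eq (is_deriveB (is_derive_cst (1 : R) x 1) dexp) _.
by rewrite !sub0r mulrN opprK.
Qed.

Lemma is_derive_enh_cdf (b x : R) : 0 < x ->
  is_derive x 1 (enh_cdf alpha lambda b) (enh_pdf b x).
Proof.
move=> x0; have G0 := nh_cdf_gt0 x0.
apply: (@near_eq_is_derive _ _ _ (fun y => nh_cdf y `^ b)).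
  by near=> y; rewrite /enh_cdf ifT//; near: y; exact: lt_nbhsr.
exact: (@is_derive1_comp _ (@powR R ^~ b) nh_cdf x _ _
  (@is_derive1_powR R b _ G0) (is_derive_nh_cdf x0)).
Unshelve. all: by end_near. Qed.

Lemma continuous_enh_pdf (b x : R) : 0 < x -> {for x, continuous (enh_pdf b)}.
Proof.
have derC (g : R -> R) (y l : R) : is_derive y 1 g l -> {for y, continuous g}.
  by move=> [dg _]; exact/differentiable_continuous/derivable1_diffP.
have powC (a : R) (g : R -> R) (y : R) : 0 < g y -> {for y, continuous g} ->
    {for y, continuous (fun z => g z `^ a)}.
  move=> gy0 cg; apply: (@continuous_comp _ _ _ g (@powR R ^~ a)) => //.
  exact/derC/is_derive1_powR.
move=> x0; have cbase := derC _ _ _ (is_derive_base x).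
have cst_ (k : R) : {for x, continuous (fun=> k)} by exact: cst_continuous.
apply: continuousM.
  apply: continuousM; first exact: cst_.
  exact: powC (nh_cdf_gt0 x0) (derC _ _ _ (is_derive_nh_cdf x0)).
apply: continuousM.
  apply: (@continuous_comp _ _ _ _ expR); last exact: continuous_expR.
  apply: continuousB; first exact: cst_.
  by apply: powC => //; exact: base_gt0.
apply: continuousM; last exact: cst_.
apply: continuousM; first exact: cst_.
by apply: powC => //; exact: base_gt0.
Qed.

(** The two densities share the factor [nh_pdf], so only powers of [nh_cdf]
    survive in the ratio. *)
Lemma enh_pdf_ratio (b c x : R) : 0 < c -> 0 < x ->
  enh_pdf b x / enh_pdf c x = b / c * nh_cdf x `^ (b - c).
Proof.
move=> c0 x0; have G0 := nh_cdf_gt0 x0.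
have -> : b - c = (b - 1) - (c - 1) by rewrite opprB addrA subrK.
rewrite powRB ?(gt_eqF G0) ?implybT// /enh_pdf -mulf_div.
by rewrite divff ?mulr1 ?mulf_div// gt_eqF ?nh_pdf_gt0.
Qed.

(** A power of a positive increasing function is nondecreasing when its exponent
    is nonnegative, and strictly decreasing when it is negative. *)
Lemma enh_pdf_ratio_nondecreasing (b c : R) : 0 < b -> 0 < c ->
  (forall x y : R, 0 < x -> x <= y ->
     enh_pdf b x / enh_pdf c x <= enh_pdf b y / enh_pdf c y) <-> c <= b.
Proof.
move=> b0 c0; have bc0 : 0 < b / c by exact: divr_gt0.
split=> [mono|cb x y x0 xy].
  rewrite leNgt; apply/negP => bc.
  (* Any two distinct positive points refute monotonicity when [b < c], because
     [nh_cdf] is strictly increasing. *)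
  have G1 := nh_cdf_gt0 (ltr01 : 0 < 1 :> R).
  have G12 : nh_cdf 1 < nh_cdf 2 by apply: nh_cdf_lt => //; rewrite ltr1n.
  have := mono 1 2 ltr01 (ler1n _ 2).
  rewrite (enh_pdf_ratio _ c0 ltr01) (enh_pdf_ratio _ c0 (ltr0Sn R 1)).
  rewrite (ler_pM2l bc0) leNgt => /negP; apply.
  by apply: (lt0_gtr_powR _ G1 G12); rewrite subr_lt0.
have y0 := lt_le_trans x0 xy.
rewrite (enh_pdf_ratio _ c0 x0) (enh_pdf_ratio _ c0 y0) (ler_pM2l bc0).
apply: ge0_ler_powR.
- by rewrite subr_ge0.
- by rewrite nnegrE; exact: ltW (nh_cdf_gt0 x0).
- by rewrite nnegrE; exact: ltW (nh_cdf_gt0 y0).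
- move: xy; rewrite le_eqVlt => /predU1P[->//|xy].
  exact: ltW (nh_cdf_lt x0 xy).
Qed.

(** Exponents add up. Positivity of [n] matters for [x <= 0]: the empty product
    is [1] whereas the right-hand side is [0]. *)
Lemma prod_enh_cdf (n : nat) (b : 'I_n -> R) (x : R) : (0 < n)%N ->
  \prod_(i < n) enh_cdf alpha lambda (b i) x =
  enh_cdf alpha lambda (\sum_(i < n) b i) x.
Proof.
rewrite /enh_cdf => n0; have [x0|x0] := ltP 0 x; last first.
  by rewrite prodr_const card_ord expr0n gtn_eqF.
rewrite -/(nh_cdf x); have G0 := nh_cdf_gt0 x0.
apply: (big_ind2 (fun p s => p = nh_cdf x `^ s)) => //; first by rewrite powRr0.
by move=> _ s _ t -> ->; rewrite powRD// (gt_eqF G0) implybT.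
Qed.

End exponentiated_Nadarajah_Haghighi.

(** * Maximum of independent ENH variables *)

Section maximum_of_ENH.
Context {d : measure_display} {T : measurableType d} {R : realType}.
Context (P : probability T R) (n : nat) (n_gt0 : (0 < n)%N).
Context (alpha lambda : R).
Hypotheses (alpha_gt0 : 0 < alpha) (lambda_gt0 : 0 < lambda).
Context (beta : 'I_n -> R).
Hypothesis beta_gt0 : forall i, 0 < beta i.
Context (X : 'I_n -> {RV P >-> R}).
Hypotheses (X_indep : mutually_independent X)
  (X_ENH : forall i, is_ENH alpha lambda (beta i) (X i)).

(** Closure of the family under maxima: this is where the sums of the shape
    parameters come from. *)
Lemma cdf_sample_max_ENH (x : R) :
  cdf (sample_max n_gt0 X : {RV P >-> R}) x =
  (enh_cdf alpha lambda (\sum_(i < n) beta i) x)%:E.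
Proof.
rewrite cdf_sample_max// -prod_enh_cdf// -prodEFin.
by apply: eq_bigr => i _; have [_ ->] := X_ENH i.
Qed.

Lemma sum_beta_gt0 : 0 < \sum_(i < n) beta i.
Proof.
rewrite (bigD1 (Ordinal n_gt0))//= ltr_pwDl// sumr_ge0// => i _.
exact: ltW.
Qed.

Let is_derive_cdf_max (x : R) : 0 < x -> is_derive x 1
  (fun y => fine (cdf (sample_max n_gt0 X : {RV P >-> R}) y))
  (enh_pdf alpha lambda (\sum_(i < n) beta i) x).
Proof.
move=> x0; under eq_fun do rewrite cdf_sample_max_ENH /=.
exact: is_derive_enh_cdf.
Qed.

Lemma has_density_sample_max_ENH :
  has_density (sample_max n_gt0 X : {RV P >-> R})
    (enh_pdf alpha lambda (\sum_(i < n) beta i)).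
Proof.
apply: has_density_derivative => //.
- by rewrite cdf_sample_max_ENH /enh_cdf ltxx.
- by move=> x x0; rewrite ltW// enh_pdf_gt0// sum_beta_gt0.
- by move=> x x0; exact: continuous_enh_pdf.
Qed.

(** Densities are equal everywhere on the positive half-line, not merely almost
    everywhere, because each is the derivative of the same function. *)
Lemma density_sample_max_ENH_unique (f : R -> R) :
  has_density (sample_max n_gt0 X : {RV P >-> R}) f ->
  forall x : R, 0 < x -> f x = enh_pdf alpha lambda (\sum_(i < n) beta i) x.
Proof.
move=> [_ _ _ df] x x0.
by have [_ <-] := df x x0; have [_ <-] := is_derive_cdf_max x0.
Qed.

End maximum_of_ENH.

Theorem theorem3p6 (R : realType)
  (d : measure_display) (T : measurableType d) (P : probability T R)
  (d' : measure_display) (T' : measurableType d') (P' : probability T' R)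
  (n : nat) (n_gt0 : (0 < n)%N)
  (alpha lambda : R) (alpha_gt0 : 0 < alpha) (lambda_gt0 : 0 < lambda)
  (beta beta' : 'I_n -> R)
  (beta_gt0 : forall i, 0 < beta i) (beta'_gt0 : forall i, 0 < beta' i)
  (X : 'I_n -> {RV P >-> R}) (X' : 'I_n -> {RV P' >-> R})
  (X_indep : mutually_independent X) (X'_indep : mutually_independent X')
  (X_ENH : forall i, is_ENH alpha lambda (beta i) (X i))
  (X'_ENH : forall i, is_ENH alpha lambda (beta' i) (X' i)) :
  lr_le (sample_max n_gt0 X' : {RV P' >-> R}) (sample_max n_gt0 X : {RV P >-> R})
  <-> \sum_(i < n) beta' i <= \sum_(i < n) beta i.
Proof.
have b_gt0 : 0 < \sum_(i < n) beta i by exact: sum_beta_gt0.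
have b'_gt0 : 0 < \sum_(i < n) beta' i by exact: sum_beta_gt0.
rewrite -(enh_pdf_ratio_nondecreasing alpha_gt0 lambda_gt0)//.
split=> [[f [g [fX' gX _ mono]]] x y x0 xy|mono].
  have y0 := lt_le_trans x0 xy; have := mono x y x0 xy.
  have f_unique :=
    density_sample_max_ENH_unique alpha_gt0 lambda_gt0 X'_indep X'_ENH fX'.
  have g_unique :=
    density_sample_max_ENH_unique alpha_gt0 lambda_gt0 X_indep X_ENH gX.
  by rewrite (f_unique x x0) (f_unique y y0) (g_unique x x0) (g_unique y y0).
exists (enh_pdf alpha lambda (\sum_(i < n) beta' i)).
exists (enh_pdf alpha lambda (\sum_(i < n) beta i)).
split=> //; [exact: has_density_sample_max_ENH..|].
by move=> x x0; exact: enh_pdf_gt0.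
Qed.
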